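(* For any invertible matrix $W\in\mathbb{R}^{(n+2m)\times(n+2m)}$, the convex set of all $\zeta=(\pi,\phi,\psi)\in\mathbb{R}^{n}\times\mathbb{R}^m\times\mathbb{R}^m$ defined by the constraints $$\pi\ge 0,\qquad \psi\ge|\phi|,\qquad A\phi=q,$$ $$\mathrm{Sy}\left(W\begin{pmatrix}0 & A & 0\\ -\mathrm{di}(b)^{-1}A_\alpha & \mathrm{di}(\psi) & \mathrm{di}(\phi)\\ 0 & -\mathrm{di}(\phi) & \mathrm{di}(\psi)\end{pmatrix}\right)\succeq 0$$ is a monotonicity domain of the gas flow operator $F$. Denote this set by $\mathcal{C}(W)$. If there is a solution to the gas flow equations in $\mathcal{C}(W)$, it must be a solution $\kappa$ to the following monotone variational inequality, where $F_W(x)=WF(x)$: $$\kappa\in\mathcal{C}(W),\qquad \langle F_W(\kappa),x-\kappa\rangle\ge 0\quad\forall x\in\mathcal{C}(W).$$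
   Context: Network. A gas network has nodes $\{0,1,\dots,n\}$ (node $0$ is the slack node) and $m$ directed edges, with at most one edge for each pair of nodes; edge $k$ goes from node $k_1$ to node $k_2$. Each edge $k$ has a known pipe constant $\lambda_k$, a compression ratio $\alpha_k\ge1$ ($\alpha_k=1$ means no compressor on edge $k$) and a relative compressor position $r_k$ along the edge. A vector $q\in\mathbb{R}^n$ of injections at nodes $1,\dots,n$ is given. Matrices. $A,B,C$ are the $n\times m$ matrices with rows indexed by the nodes $i\in\{1,\dots,n\}$ and columns by edges $k$: $B_{ik}=1$ if $k_1=i$ and $0$ otherwise; $C_{ik}=-1$ if $k_2=i$ and $0$ otherwise; $A=B+C$. Put $A_\alpha=(B\,\mathrm{di}(\alpha)+C)^T\in\mathbb{R}^{m\times n}$ and let $b\in\mathbb{R}^m$ have entries $b_k=(\alpha_k r_k+1-r_k)\lambda_k$, all assumed positive. Notation. $\mathrm{di}(x)$ is the diagonal matrix with diagonal $x$; $x*y$ is the entrywise product; squares, absolute values and inequalities between vectors are entrywise; $\mathrm{Sy}(M)=M+M^T$; $\langle\cdot,\cdot\rangle$ is the Euclidean inner product; $\succeq 0$ means positive semidefinite. Gas flow operator. For $\zeta=(\pi,\phi,\psi)\in\mathbb{R}^n\times\mathbb{R}^m\times\mathbb{R}^m$ (squared pressures, flows, auxiliary flow magnitudes), $$F(\zeta)=\begin{pmatrix}A\phi-q\\ A_\alpha\pi-b*\phi*\psi\\ \phi^2-\psi^2\end{pmatrix}\in\mathbb{R}^{n+2m}.$$ The gas flow equations are $F(\zeta)=0$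 together with $\pi\ge0$, $\psi\ge0$. Monotonicity. $H:\mathbb{R}^N\to\mathbb{R}^N$ is monotone over a set $S$ if $\langle H(x)-H(y),x-y\rangle\ge0$ for all $x,y\in S$. A convex set $S\subset\mathbb{R}^{n+2m}$ is a monotonicity domain of $F$ if there exists an invertible matrix $V$ such that $x\mapsto VF(x)$ is monotone over $S$, and every $(\pi,\phi,\psi)\in S$ satisfies $\pi\ge0$, $\psi\ge|\phi|$, $A\phi=q$.
   Formalization: W F need not be monotone on C(W), so the inequality for F_W = W F is proved without the word ''monotone''; it is also proved for the operator W D F, D = blockdiag(I, -di(b)^{-1}, -I/2), which is monotone on C(W). *)

(* Defs.v *)
From HB Require Import structures.
From mathcomp Require Import all_boot all_order all_algebra.
From mathcomp Require Import all_classical all_reals convex.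

Set Implicit Arguments.
Unset Strict Implicit.
Unset Printing Implicit Defensive.
Import Order.TTheory GRing.Theory Num.Theory.
Local Open Scope ring_scope.

Definition di (R : pzRingType) (n : nat) (x : 'cV[R]_n) : 'M[R]_n :=
  diag_mx x^T.

Definition Sy (R : pzRingType) (n : nat) (M : 'M[R]_n) : 'M[R]_n := M + M^T.

Definition emul (R : pzRingType) (n : nat) (x y : 'cV[R]_n) : 'cV[R]_n :=
  map2_mx *%R x y.

Definition esqr (R : pzRingType) (n : nat) (x : 'cV[R]_n) : 'cV[R]_n :=
  map_mx (fun t => t ^+ 2) x.

Definition eabs (R : realType) (n : nat) (x : 'cV[R]_n) : 'cV[R]_n :=
  map_mx Num.norm x.

Definition vle (R : realType) (n : nat) (x y : 'cV[R]_n) : Prop :=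
  forall i, x i 0 <= y i 0.

Definition dotv (R : pzRingType) (n : nat) (x y : 'cV[R]_n) : R :=
  \sum_i x i 0 * y i 0.

Definition psd (R : realType) (n : nat) (M : 'M[R]_n) : Prop :=
  M^T = M /\ forall x : 'cV[R]_n, 0 <= dotv x (M *m x).

Definition monotone_over (R : realType) (n : nat)
    (H : 'cV[R]_n -> 'cV[R]_n) (S : set 'cV[R]_n) : Prop :=
  forall x y, S x -> S y -> 0 <= dotv (H x - H y) (x - y).

Definition solves_VI (R : realType) (n : nat)
    (H : 'cV[R]_n -> 'cV[R]_n) (S : set 'cV[R]_n) (kappa : 'cV[R]_n) : Prop :=
  S kappa /\ forall x, S x -> 0 <= dotv (H kappa) (x - kappa).

(* Node [ord0] is the slack node; row [i : 'I_n] of the matrices below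
   corresponds to the node [lift ord0 i], whose value is [i.+1]. *)
Record gas_network (R : realType) (n m : nat) := GasNetwork {
  src : 'I_m -> 'I_n.+1;
  dst : 'I_m -> 'I_n.+1;
  pipe_const : 'cV[R]_m;
  comp_ratio : 'cV[R]_m;
  comp_pos : 'cV[R]_m
}.

(* Pairs are unordered: antiparallel edges are excluded as well. *)
Definition simple_network (R : realType) (n m : nat)
    (N : gas_network R n m) : Prop :=
  injective (fun k => [set src N k; dst N k]%SET).

Section GasFlow.
Variables (R : realType) (n m : nat) (N : gas_network R n m) (q : 'cV[R]_n).

Definition Bmx : 'M[R]_(n, m) :=
  \matrix_(i, k) (if src N k == lift ord0 i then 1 else 0).

Definition Cmx : 'M[R]_(n, m) :=
  \matrix_(i, k) (if dst N k == lift ord0 i then -1 else 0).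

Definition Amx : 'M[R]_(n, m) := Bmx + Cmx.

Definition Aalpha : 'M[R]_(m, n) := (Bmx *m di (comp_ratio N) + Cmx)^T.

Definition bvec : 'cV[R]_m :=
  \col_k ((comp_ratio N k 0 * comp_pos N k 0 + 1 - comp_pos N k 0)
          * pipe_const N k 0).

(* A point (pi, phi, psi) is stacked into one column of height n + (m + m). *)
Definition zpi (z : 'cV[R]_(n + (m + m))) : 'cV[R]_n := usubmx z.
Definition zphi (z : 'cV[R]_(n + (m + m))) : 'cV[R]_m := usubmx (dsubmx z).
Definition zpsi (z : 'cV[R]_(n + (m + m))) : 'cV[R]_m := dsubmx (dsubmx z).

Definition gasF (z : 'cV[R]_(n + (m + m))) : 'cV[R]_(n + (m + m)) :=
  col_mx (Amx *m zphi z - q)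
    (col_mx (Aalpha *m zpi z - emul (emul bvec (zphi z)) (zpsi z))
            (esqr (zphi z) - esqr (zpsi z))).

Definition gas_flow_solution (z : 'cV[R]_(n + (m + m))) : Prop :=
  [/\ gasF z = 0, vle 0 (zpi z) & vle 0 (zpsi z)].

Definition monotonicity_domain (S : set 'cV[R]_(n + (m + m))) : Prop :=
  [/\ convex_set S,
      exists2 V : 'M[R]_(n + (m + m)),
        V \in unitmx & monotone_over (fun x => V *m gasF x) S
    & forall z, S z ->
        [/\ vle 0 (zpi z), vle (eabs (zphi z)) (zpsi z)
          & Amx *m zphi z = q]].

Definition Mmx (z : 'cV[R]_(n + (m + m))) : 'M[R]_(n + (m + m)) :=
  block_mx 0 (row_mx Amx 0)
           (col_mx (- invmx (di bvec) *m Aalpha) 0)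
           (block_mx (di (zpsi z)) (di (zphi z))
                     (- di (zphi z)) (di (zpsi z))).

Definition Cset (W : 'M[R]_(n + (m + m))) : set 'cV[R]_(n + (m + m)) :=
  fun z => [/\ vle 0 (zpi z), vle (eabs (zphi z)) (zpsi z),
               Amx *m zphi z = q & psd (Sy (W *m Mmx z))].

(* [Mmx z] is [Dmx] times the Jacobian of [gasF] at [z]; hence the constraint
   defining [Cset W] says that [W *m Dmx *m gasF], not [W *m gasF], has a
   Jacobian with positive semidefinite symmetric part. *)
Definition Dmx : 'M[R]_(n + (m + m)) :=
  block_mx 1%:M 0 0 (block_mx (- invmx (di bvec)) 0 0 (- 2^-1)%:M).

End GasFlow.

(* Main.v *)
Require Import Defs.
From HB Require Import structures.
From mathcomp Require Import all_boot all_order all_algebra.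
From mathcomp Require Import all_classical all_reals convex.
From mathcomp Require Import ring interval_inference.
Import Order.TTheory GRing.Theory Num.Theory.
Local Open Scope ring_scope.

(* The operator [gasF] is quadratic, so its secant matrix between [x] and [y]
   is exactly its Jacobian at the midpoint of [x] and [y]. Up to the invertible
   left factor [Dmx] this Jacobian is [Mmx], which is affine in the point.
   Affinity makes [Cset W] convex, hence it contains the midpoint, and positive
   semidefiniteness there is the monotonicity inequality. *)

Lemma dotvE (R : pzRingType) (n : nat) (x y : 'cV[R]_n) :
  dotv x y = (x^T *m y) 0 0.
Proof. by rewrite mxE; apply: eq_bigr => i _; rewrite mxE. Qed.

Lemma dotvC (R : comPzRingType) (n : nat) (x y : 'cV[R]_n) :
  dotv x y = dotv y x.
Proof. by apply: eq_bigr => i _; rewrite mulrC. Qed.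

(** A matrix and its transpose have the same quadratic form, so semidefiniteness of [Sy M] bounds
    the form of [M] itself. *)
Lemma dotv_Sy (R : comPzRingType) (n : nat) (M : 'M[R]_n) (x : 'cV[R]_n) :
  dotv x (Sy M *m x) = dotv x (M *m x) *+ 2.
Proof.
have -> : dotv x (M *m x) *+ 2 = dotv x (M *m x) + dotv (M *m x) x.
  by rewrite [dotv (M *m x) x]dotvC mulr2n.
by rewrite !dotvE trmx_mul -mulmxA mulmxDl mulmxDr mxE.
Qed.

Lemma psdD (R : realType) (n : nat) (P Q : 'M[R]_n) :
  psd P -> psd Q -> psd (P + Q).
Proof.
move=> [symP posP] [symQ posQ]; split=> [|x]; first by rewrite linearD /= symP symQ.
have := addr_ge0 (posP x) (posQ x).
by rewrite !dotvE mulmxDl mulmxDr [X in _ -> _ <= X]mxE.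
Qed.

Lemma psdZ (R : realType) (n : nat) (a : R) (P : 'M[R]_n) :
  0 <= a -> psd P -> psd (a *: P).
Proof.
move=> a0 [symP posP]; split=> [|x]; first by rewrite linearZ /= symP.
have := mulr_ge0 a0 (posP x).
by rewrite !dotvE -scalemxAl -scalemxAr [X in _ -> _ <= X]mxE.
Qed.

Lemma Sy_mulmxP (R : comPzRingType) (n : nat) (a b : R) (W P Q : 'M[R]_n) :
  Sy (W *m (a *: P + b *: Q)) = a *: Sy (W *m P) + b *: Sy (W *m Q).
Proof.
by rewrite /Sy mulmxDr -!scalemxAr linearD !linearZ /= addrACA !scalerDr.
Qed.

(** At a zero of [H] every inner product in the inequality vanishes. *)
Lemma solves_VI_zero (R : realType) (n : nat) (H : 'cV[R]_n -> 'cV[R]_n)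
    (S : set 'cV[R]_n) (kappa : 'cV[R]_n) :
  S kappa -> H kappa = 0 -> solves_VI H S kappa.
Proof.
move=> Sk Hk; split=> // x _.
by rewrite Hk dotvE trmx0 mul0mx mxE.
Qed.

Lemma di_unitmx (R : fieldType) (n : nat) (x : 'cV[R]_n) :
  (forall i, x i 0 != 0) -> di x \in unitmx.
Proof.
move=> x0; rewrite unitmxE det_diag unitfE prodf_seq_neq0.
by apply/allP => i _; rewrite mxE x0.
Qed.

Lemma diE (R : pzRingType) (n : nat) (x y : 'cV[R]_n) : di x *m y = emul x y.
Proof. by apply/matrixP => i j; rewrite mul_diag_mx !mxE ord1. Qed.

Section GasFlowMonotone.
Variables (R : realType) (n m : nat) (N : gas_network R n m) (q : 'cV[R]_n).
Implicit Types (x y z : 'cV[R]_(n + (m + m))) (W : 'M[R]_(n + (m + m))).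

Lemma zpi_is_linear : linear (@zpi R n m).
Proof. by move=> a x y; apply/matrixP => i j; rewrite !mxE. Qed.
HB.instance Definition _ := GRing.isLinear.Build R _ _ _ _ zpi_is_linear.

Lemma zphi_is_linear : linear (@zphi R n m).
Proof. by move=> a x y; apply/matrixP => i j; rewrite !mxE. Qed.
HB.instance Definition _ := GRing.isLinear.Build R _ _ _ _ zphi_is_linear.

Lemma zpsi_is_linear : linear (@zpsi R n m).
Proof. by move=> a x y; apply/matrixP => i j; rewrite !mxE. Qed.
HB.instance Definition _ := GRing.isLinear.Build R _ _ _ _ zpsi_is_linear.

Lemma di_is_linear : linear (@di R m).
Proof. by move=> a x y; rewrite /di !linearP. Qed.
HB.instance Definition _ := GRing.isLinear.Build R _ _ _ _ di_is_linear.

(** The blocks in [psi] and [phi] are linear; the constant blocks [Amx] and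
    [- invmx (di bvec) *m Aalpha] are what require weights of sum 1. *)
Lemma Mmx_affine (a b : R) x y : a + b = 1 ->
  Mmx N (a *: x + b *: y) = a *: Mmx N x + b *: Mmx N y.
Proof.
move=> ab1; rewrite /Mmx !linearP /= !linearZ /=.
rewrite !scale_block_mx !scale_row_mx !scale_col_mx.
rewrite !add_block_mx !add_row_mx !add_col_mx !scaler0 !addr0.
by rewrite -!scalerDl ab1 !scale1r.
Qed.

Lemma Cset_convex W (t : R) x y : 0 <= t <= 1 ->
  Cset N q W x -> Cset N q W y -> Cset N q W (t *: x + (1 - t) *: y).
Proof.
move=> /andP[t0 t1] [px fx ax sx] [py fy ay sy].
have t'0 : 0 <= 1 - t by rewrite subr_ge0.
rewrite /Cset !linearP /= !linearZ /=; split.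
- by move=> i; have := px i; have := py i; rewrite !mxE => *; rewrite addr_ge0 ?mulr_ge0.
- move=> i; have := fx i; have := fy i; rewrite !mxE => yi xi.
  apply: le_trans (ler_normD _ _) _; rewrite !normrM (ger0_norm t0) (ger0_norm t'0).
  by rewrite lerD ?ler_wpM2l.
- by rewrite ax ay -scalerDl subrKC scale1r.
rewrite (Mmx_affine _ _ _ _ (subrKC t 1)) Sy_mulmxP.
by apply: psdD; [apply: psdZ t0 sx | apply: psdZ t'0 sy].
Qed.

(** Block diagonality reduces this to the three diagonal blocks; positivity of [bvec] settles the
    middle one. *)
Lemma Dmx_unitmx : (forall k, 0 < bvec N k 0) -> Dmx N \in unitmx.
Proof.
move=> b0; rewrite !block_diag_mx_unit unitmx1 /= -scaleN1r.
rewrite unitmxZ ?unitrN1 // unitmx_inv di_unitmx; last by move=> k; rewrite gt_eqF.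
by rewrite unitmxE det_scalar unitrX // unitrN unitrV unitfE pnatr_eq0.
Qed.

(** The exact secant identity. The midpoint is written with weights [2^-1] and [1 - 2^-1] to match
    the form of [Cset_convex]. *)
Lemma Dmx_gasFB x y : (forall k, 0 < bvec N k 0) ->
  Dmx N *m (gasF N q x - gasF N q y) =
  Mmx N (2^-1 *: x + (1 - 2^-1) *: y) *m (x - y).
Proof.
move=> b0.
have bU : di (bvec N) \in unitmx by apply: di_unitmx => k; rewrite gt_eqF.
have zE z : z = col_mx (zpi z) (col_mx (zphi z) (zpsi z)) by rewrite !vsubmxK.
rewrite [X in _ = _ *m X]zE /Dmx /Mmx /gasF.
rewrite opp_col_mx add_col_mx opp_col_mx add_col_mx.
rewrite !mul_block_col !mul_row_col !mul_col_mx !add_col_mx.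
rewrite !mul0mx !add0r !addr0 mul1mx.
congr col_mx; first by rewrite opprB addrA subrK -mulmxBr [zphi (x - y)]linearB.
congr col_mx.
  (* As a left matrix factor, [di (bvec N)] cancels against the inverse in [Dmx N]. *)
  have bE u v : emul (emul (bvec N) u) v = di (bvec N) *m emul u v.
    by rewrite diE; apply/matrixP => i j; rewrite !mxE mulrA.
  rewrite !bE opprD opprK addrACA [- (di _ *m _) + _]addrC -!mulmxBr mulmxDr.
  rewrite mulmxA [zpi (x - y)]linearB; congr (_ + _).
  rewrite mulNmx mulKmx // !diE.
  (* Entrywise, $uv-u'v'=\frac{v+v'}{2}(u-u')+\frac{u+u'}{2}(v-v')$. *)
  by apply/matrixP => i j; rewrite !mxE; field.
(* The factor [- 2^-1] turns $u^2-u'^2=(u+u')(u-u')$ into minus the mean times the difference. *)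
rewrite mul_scalar_mx mulNmx !diE.
by apply/matrixP => i j; rewrite !mxE; field.
Qed.

Lemma Cset_monotone W : (forall k, 0 < bvec N k 0) ->
  monotone_over (fun x => W *m Dmx N *m gasF N q x) (Cset N q W).
Proof.
move=> b0 x y Cx Cy.
have half01 : 0 <= (2^-1 : R) <= 1 by rewrite invr_ge0 ler0n /= invf_le1 ?ler1n ?ltr0n.
(* The matrix constraint at the midpoint is tested on the vector [x - y]. *)
have [_ _ _ [_ /(_ (x - y))]] := Cset_convex W _ _ _ half01 Cx Cy.
by rewrite dotv_Sy pmulrn_lge0 // dotvC -mulmxBr -!mulmxA Dmx_gasFB // dotvC.
Qed.

End GasFlowMonotone.

(* The last conjunct gives the variational inequality for the operator
   [W *m Dmx N *m gasF N q x], which is the one that is monotone on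
   [Cset N q W] for every W; [W *m gasF N q x] need not be. *)
Theorem mainTheorem1 (R : realType) (n m : nat) (N : gas_network R n m)
    (q : 'cV[R]_n)
    (N_simple : simple_network N)
    (ratio_ge1 : forall k, 1 <= comp_ratio N k 0)
    (b_gt0 : forall k, 0 < bvec N k 0)
    (W : 'M[R]_(n + (m + m))) (W_unit : W \in unitmx) :
  [/\ monotonicity_domain N q (Cset N q W),
      (forall kappa, gas_flow_solution N q kappa -> Cset N q W kappa ->
         solves_VI (fun x => W *m gasF N q x) (Cset N q W) kappa)
    & [/\ W *m Dmx N \in unitmx,
          monotone_over (fun x => W *m Dmx N *m gasF N q x) (Cset N q W)
        & forall kappa, gas_flow_solution N q kappa -> Cset N q W kappa ->
            solves_VI (fun x => W *m Dmx N *m gasF N q x) (Cset N q W) kappa]].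
Proof.
have VU : W *m Dmx N \in unitmx by rewrite unitmx_mul W_unit Dmx_unitmx.
have mon := Cset_monotone _ _ _ _ q W b_gt0.
(* Stated for every [V], to serve both [W] and [W *m Dmx N]. *)
have sol (V : 'M[R]_(n + (m + m))) kappa :
    gas_flow_solution N q kappa -> Cset N q W kappa ->
    solves_VI (fun x => V *m gasF N q x) (Cset N q W) kappa.
  by move=> [F0 _ _] Ck; apply: solves_VI_zero => //; rewrite F0 mulmx0.
split; [split | exact: sol | by split; [exact: VU | exact: mon | exact: sol]].
- move=> x y t /set_mem Cx /set_mem Cy; apply/mem_set.
  by apply: (Cset_convex _ _ _ _ _ _ _ _ _ _ Cx Cy); rewrite ge0 le1.
(* The matrix constraint concerns [W] times [Dmx N] times the Jacobian, so the witness is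
   [W *m Dmx N]. *)
- by exists (W *m Dmx N); [exact: VU | exact: mon].
- by move=> z [].
Qed.
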